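(* Let $E>2525$ be an even number with S.C.E quantities $a_E,b_E,c_E,d_E$ (defined in the context). Suppose that none of the following three relations holds: $d_E<b_E<c_E<a_E$; $d_E<b_E=c_E<a_E$; $d_E<c_E<b_E<a_E$. Then $d_E>0$ (equivalently, $E$ is a sum of two odd primes).
   Context: For a positive even number $E$, an additive interaction of $E$ is a pair $x\sim y$ of odd positive integers $x,y<E$ with $x\leq y$ and $x+y=E$. An odd number is called nonprime if it is not prime (in particular $1$ is nonprime). Define $a_E=\#\{x\sim y: x\neq y,\ x,y \text{ nonprime}\}+\frac12\#\{x\sim x: x \text{ nonprime}\}$, $b_E=\#\{x\sim y: x \text{ nonprime},\ y \text{ prime}\}$, $c_E=\#\{x\sim y: x \text{ prime},\ y \text{ nonprime}\}$, $d_E=\#\{x\sim y: x\neq y,\ x,y \text{ primes}\}+\frac12\#\{x\sim x: x \text{ prime}\}$, where all counts range over additive interactions of $E$. Then $\frac{E}{4}=a_E+b_E+c_E+d_E$. *)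

(* Defs.v *)
From mathcomp Require Import all_boot all_order all_algebra.

Set Implicit Arguments.
Unset Strict Implicit.
Unset Printing Implicit Defensive.

Import GRing.Theory Num.Theory.

(* Positivity of both members is implied by oddness; both bounds x, y < E are
   carried by the ordinal type. *)
Definition interactions (E : nat) : {set 'I_E * 'I_E} :=
  [set u : 'I_E * 'I_E | [&& odd u.1, odd u.2, u.1 <= u.2 & u.1 + u.2 == E]]%N.

Local Open Scope ring_scope.

Definition aE (E : nat) : rat :=
  #|[set u in interactions E |
      [&& u.1 != u.2, ~~ prime u.1 & ~~ prime u.2]]|%:R
  + 1 / 2 * #|[set u in interactions E | (u.1 == u.2) && ~~ prime u.1]|%:R.

Definition bE (E : nat) : rat :=
  #|[set u in interactions E | ~~ prime u.1 && prime u.2]|%:R.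

Definition cE (E : nat) : rat :=
  #|[set u in interactions E | prime u.1 && ~~ prime u.2]|%:R.

Definition dE (E : nat) : rat :=
  #|[set u in interactions E | [&& u.1 != u.2, prime u.1 & prime u.2]]|%:R
  + 1 / 2 * #|[set u in interactions E | (u.1 == u.2) && prime u.1]|%:R.

(* Main.v *)
Require Import Defs.
From mathcomp Require Import all_boot all_order all_algebra.
From mathcomp Require Import zify lra.

Import GRing.Theory Num.Theory.

(** Write E = 2n and suppose d_E = 0. Then b_E is the number of primes in
    (n, 2n), which is positive by Bertrand's postulate (proved as by Erdős,
    from the size of the central binomial coefficient), and c_E is the number
    of odd primes up to n. Chebyshev's bound prod_{k+1 < p <= 2k+1} p <= 4^k
    shows that at most k/6 primes lie in (k+1, 2k+1] once k + 2 >= 2^12; with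
    a finite computation this yields pi(n) <= n/6 for n >= 1134 and
    pi(2n) - pi(n) <= n/6 for n >= 1263. Hence b_E <= n/6 and c_E < n/6, and
    a_E = n/2 - b_E - c_E exceeds both, so that one of the three excluded
    relations holds. *)

Set Implicit Arguments.
Unset Strict Implicit.
Unset Printing Implicit Defensive.

(** * Prime counting and the finite range of the estimates *)

Definition prime_pi (n : nat) : nat := \sum_(0 <= p < n.+1 | prime p) 1.

Lemma prime_piS n : prime_pi n.+1 = prime n.+1 + prime_pi n.
Proof. by rewrite /prime_pi big_mkcond big_nat_recr //= -big_mkcond addnC; case: prime. Qed.

(* Running through n, n+1, ... with c1 = prime_pi n and c2 = prime_pi (2n+1), so
   that vm_compute tests each number for primality at most twice. *)
Fixpoint pi_scan (P : nat -> nat -> nat -> bool) (k n c1 c2 : nat) : bool :=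
  if k is k'.+1 then
    P n c1 c2 && pi_scan P k' n.+1 (prime n.+1 + c1) (prime n.*2.+3 + c2)
  else true.

Lemma prime_pi_double n : 0 < n -> prime_pi n.*2.+2 = prime_pi n.*2.+1.
Proof.
move=> n0; rewrite prime_piS; case: (boolP (prime _)) => // /even_prime [|]; first lia.
by rewrite /= odd_double.
Qed.

Lemma pi_scanP P k n m :
  0 < n -> pi_scan P k n (prime_pi n) (prime_pi n.*2.+1) ->
  n <= m < n + k -> P m (prime_pi m) (prime_pi m.*2.+1).
Proof.
elim: k n => [|k IH] n n0 /=; first by lia.
move=> /andP[Pn Hs] /andP[le1 lt1].
case: (eqVneq n m) => [<- //|ne].
apply: (IH n.+1) => //; last lia.
by rewrite doubleS 2!prime_piS -prime_piS prime_pi_double // prime_piS.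
Qed.

(** The clauses are the finite cases of the two bounds on [prime_pi] below; 1263 is half the least
    even number above 2525. *)
Definition small_check n c1 c2 :=
  ((n < 567) || (6 * c2 <= n.*2.+1)) && ((n < 1263) || (6 * c2 <= n + 6 * c1)).

(** The scan stops at 4096 = 2 ^ 12, where Chebyshev's bound takes over. *)
Lemma small_checkP n : 0 < n -> n < 1 + 4096 ->
  small_check n (prime_pi n) (prime_pi n.*2.+1).
Proof.
move=> n0 ltn; apply: (@pi_scanP small_check 4096 1 n isT); last by rewrite n0 ltn.
have -> : prime_pi 1 = 0 by rewrite /prime_pi unlock.
have -> : prime_pi 1.*2.+1 = 2 by rewrite /prime_pi unlock.
by vm_compute.
Qed.

(** * Chebyshev bounds through products of primes *)

Definition prime_prod (m n : nat) : nat := \prod_(m.+1 <= p < n.+1 | prime p) p.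

Lemma prime_prod_gt0 m n : 0 < prime_prod m n.
Proof. by apply: prodn_cond_gt0 => p /prime_gt0. Qed.

Lemma prime_prodS m n : m <= n ->
  prime_prod m n.+1 = (if prime n.+1 then n.+1 else 1) * prime_prod m n.
Proof.
by move=> lemn; rewrite /prime_prod big_mkcond big_nat_recr //= -big_mkcond mulnC.
Qed.

Lemma prime_prodnn m : prime_prod m m = 1.
Proof. by rewrite /prime_prod big_geq. Qed.

Lemma prime_prod_cat l m n : l <= m <= n ->
  prime_prod l n = prime_prod l m * prime_prod m n.
Proof. by case/andP=> lm mn; rewrite /prime_prod -big_cat_nat. Qed.

Lemma prime_prod_dvd m n N :
  (forall p, prime p -> m < p <= n -> p %| N) -> prime_prod m n %| N.
Proof.
elim: n => [|n IH] dvdN; first by rewrite /prime_prod big_geq ?dvd1n.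
have [ltnm|lemn] := ltnP n m.
  by rewrite /prime_prod big_geq ?dvd1n.
have dvdI : prime_prod m n %| N.
  by apply: IH => p pp /andP[mp pn]; apply: dvdN => //; rewrite mp leqW.
rewrite prime_prodS //; case: ifP => [pn1|_]; last by rewrite mul1n.
rewrite Gauss_dvd; first by rewrite dvdI dvdN ?ltnS ?lemn ?leqnn.
rewrite /prime_prod big_nat_cond; apply: (big_ind (fun x => coprime n.+1 x)) => [|x y cx cy|p].
- by rewrite coprimen1.
- by rewrite coprimeMr cx.
case/andP=> /andP[_ ltp] pp; rewrite prime_coprime //.
by rewrite gtnNdvd ?prime_gt0.
Qed.

Lemma prime_pi_le m n : m <= n -> prime_pi m <= prime_pi n.
Proof.
by move=> le; rewrite /prime_pi [leqRHS](@big_cat_nat _ _ _ m.+1) //= leq_addr.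
Qed.

Lemma expn_prime_pi m n : m <= n ->
  m.+1 ^ (prime_pi n - prime_pi m) <= prime_prod m n.
Proof.
elim: n => [|n IH]; first by case: m => //; rewrite subnn prime_prodnn.
rewrite leq_eqVlt => /predU1P[-> |]; first by rewrite subnn prime_prodnn.
rewrite ltnS => lemn; rewrite prime_prodS // prime_piS.
case: ifP => _; last by rewrite add0n mul1n IH.
by rewrite -addnBA ?prime_pi_le // add1n expnS leq_mul ?IH // ltnW.
Qed.

(** The prime divides [n!] but neither [k!] nor [(n - k)!]. *)
Lemma prime_dvd_binomial p n k : prime p -> k < p -> n - k < p -> p <= n ->
  p %| 'C(n, k).
Proof.
move=> pp kp nkp pn; have kn : k <= n by lia.
have nf m : m < p -> ~~ (p %| m`!).
  elim: m => [|m IH] lt; first by rewrite dvdn1; case: eqP pp => [->|].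
  by rewrite factS Euclid_dvdM // negb_or IH ?andbT; [rewrite gtnNdvd|lia].
have : p %| n`! by rewrite dvdn_fact // prime_gt0.
by rewrite -(bin_fact kn) !Euclid_dvdM // (negbTE (nf _ kp)) (negbTE (nf _ nkp)) !orbF.
Qed.

(** The two middle coefficients of row 2k+1 are equal, and the row sums to 2 * 4^k. *)
Lemma bin_odd_le k : 'C(k.*2.+1, k) <= 4 ^ k.
Proof.
have H : 2 * 4 ^ k = \sum_(i < k.*2.+2) 'C(k.*2.+1, i).
  rewrite -[4]/(2 ^ 2) -expnM -expnS mul2n -[2]/(1 + 1) expnDn; apply: eq_bigr => i _.
  by rewrite !exp1n !muln1.
have lk : k < k.*2.+2 by lia. have lk1 : k.+1 < k.*2.+2 by lia.
have eqb : 'C(k.*2.+1, k.+1) = 'C(k.*2.+1, k).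
  by rewrite -[in RHS]bin_sub; [congr binomial; lia|lia].
move: H; rewrite (bigD1 (Ordinal lk)) //= (bigD1 (Ordinal lk1)) //=; last first.
  by rewrite -val_eqE /=; lia.
rewrite eqb; lia.
Qed.

Lemma prime_prod_odd_le k : prime_prod k.+1 k.*2.+1 <= 4 ^ k.
Proof.
apply: leq_trans (bin_odd_le k); apply: dvdn_leq; first by rewrite bin_gt0; lia.
by apply: prime_prod_dvd => p pp /andP[? ?]; apply: prime_dvd_binomial => //; lia.
Qed.

(** Erdős's induction: an odd n = 2k+1 is split at k+1, the upper part being bounded by
    [prime_prod_odd_le]; an even n > 2 adds no prime. *)
Lemma primorial_le n : prime_prod 0 n <= 4 ^ n.
Proof.
have [m le] := ubnP n; elim: m n le => // m IH n ltm.
have [n2|n3] := leqP n 2.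
  by case: n n2 {ltm} => [|[|[|]]] //; rewrite /prime_prod unlock.
have [on|en] := boolP (odd n).
  have en : n = (n./2).*2.+1 by have := odd_double_half n; rewrite on; lia.
  rewrite en (@prime_prod_cat 0 (n./2).+1); last lia.
  apply: leq_trans (leq_mul (IH _ _) (prime_prod_odd_le _)) _; first lia.
  by rewrite -expnD leq_exp2l //; lia.
have e : n = n.-1.+1 by lia.
rewrite e prime_prodS // -e; case: ifP => [/even_prime|_]; first by rewrite (negbTE en); lia.
rewrite mul1n; apply: leq_trans (IH _ _) _; first lia.
by rewrite leq_exp2l //; lia.
Qed.

(** Each prime in (k+1, 2k+1] is at least 2^a, while their product is at most 4^k; the exponents of
    2 are compared. *)
Lemma prime_pi_odd_sub a k : 2 ^ a <= k.+2 ->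
  a * (prime_pi k.*2.+1 - prime_pi k.+1) <= 2 * k.
Proof.
move=> le; rewrite -(@leq_exp2l 2) // expnM [2 ^ (2 * k)]expnM -[2 ^ 2]/4.
apply: leq_trans (prime_prod_odd_le k).
have le1 : k.+1 <= k.*2.+1 by lia.
apply: leq_trans (expn_prime_pi le1).
set e := _ - _; case: (posnP e) => [-> //|e0]; by rewrite leq_exp2r.
Qed.

(** Strong induction from 2k+1 down to k+1: beyond the scanned range [a = 12] gives at most k/6 new
    primes, and (k+1)/6 + k/6 is exactly (2k+1)/6. *)
Lemma prime_pi_sixth n : 1134 <= n -> 6 * prime_pi n <= n.
Proof.
have [m le] := ubnP n; elim: m n le => // m IH n ltm le.
have step k : 567 <= k -> k.+1 < m -> 6 * prime_pi k.*2.+1 <= k.*2.+1.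
  move=> k1 k2; have [ks|kl] := leqP k 4096.
    by have := @small_checkP k; rewrite /small_check; lia.
  have := @prime_pi_odd_sub 12 k; have := IH k.+1.
  by have := @prime_pi_le k.+1 k.*2.+1; lia.
have [on|en] := boolP (odd n).
  have en : n = (n./2).*2.+1 by have := odd_double_half n; rewrite on; lia.
  by rewrite en step //; lia.
have en' : n = (n./2).*2 by have := odd_double_half n; rewrite (negbTE en); lia.
(* The bound obtained is n+1, which is odd; since the left side is even, it is at most n. *)
have := @prime_pi_le n (n./2).*2.+1; have := step n./2; lia.
Qed.

Lemma prime_pi_double_sub n : 1263 <= n ->
  6 * prime_pi n.*2 <= n + 6 * prime_pi n.
Proof.
move=> le; have [ns|nl] := leqP n 4096.
  by have := @small_checkP n; rewrite /small_check; have := @prime_pi_le n.*2 n.*2.+1; lia.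
(* With n = k+1, the endpoint 2k+2 is not prime, so only (k+1, 2k+1] counts. *)
case: n le nl => // k _ nl; rewrite doubleS.
rewrite prime_pi_double; last lia.
have := @prime_pi_odd_sub 12 k.
by have := @prime_pi_le k.+1 k.*2.+1; lia.
Qed.

(** * Bertrand's postulate from the central binomial coefficient *)

Lemma central_bin_lower n : 0 < n -> 4 ^ n <= n.*2 * 'C(n.*2, n).
Proof.
elim: n => // n IH _; case: n IH => [//|n IH].
set m := n.+1 in IH *; have {}IH : 4 ^ m <= m.*2 * 'C(m.*2, m) by apply: IH.
(* Together these give (m+1) C(2m+2, m+1) = 2 (2m+1) C(2m, m). *)
have H1 := mul_bin_diag m.*2.+2 m; have H2 := mul_bin_down m.*2.+1 m.
rewrite /= in H1 H2; rewrite doubleS expnS.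
have e1 : m.*2.+1 - m = m.+1 by lia.
rewrite e1 in H2; nia.
Qed.

(** Legendre's formula for (2n)! and n!, written additively and with a common range so that the sums
    compare term by term. *)
Lemma logn_central_bin p n : prime p ->
  logn p 'C(n.*2, n) + 2 * \sum_(1 <= k < n.*2.+1) n %/ p ^ k =
  \sum_(1 <= k < n.*2.+1) n.*2 %/ p ^ k.
Proof.
move=> pp; have len : n <= n.*2 by lia.
have <- : logn p n`! = \sum_(1 <= k < n.*2.+1) n %/ p ^ k.
  rewrite logn_fact // [RHS](@big_cat_nat _ _ _ n.+1) //=.
  rewrite [X in _ = _ + X]big_nat_cond [X in _ = _ + X]big1 ?addn0 // => k /andP[/andP[ltk _] _].
  by apply: divn_small; apply: ltn_trans ltk _; apply/ltn_expl/prime_gt1.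
rewrite -logn_fact // -(bin_fact len) !lognM ?muln_gt0 ?fact_gt0 ?bin_gt0 //.
have -> : n.*2 - n = n by lia. lia.
Qed.

(** Passing from n to 2n, the k-th floor exceeds its double by at most 1, and vanishes once p^k >
    2n. *)
Lemma logn_central_bin_le p n : prime p -> 0 < n ->
  logn p 'C(n.*2, n) <= trunc_log p n.*2.
Proof.
move=> pp n0; have := logn_central_bin n pp; set t := trunc_log _ _.
have sumt m : \sum_(1 <= k < m.+1) (k <= t) <= t.
  suff -> : \sum_(1 <= k < m.+1) (k <= t) = minn m t by lia.
  by elim: m => [|m IH]; [rewrite big_geq // min0n | rewrite big_nat_recr //= IH; lia].
have : \sum_(1 <= k < n.*2.+1) n.*2 %/ p ^ k <=
   \sum_(1 <= k < n.*2.+1) (2 * (n %/ p ^ k) + (k <= t)).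
  apply: leq_sum => k _; case: (leqP k t) => [_|tk].
    have pk : 0 < p ^ k by rewrite expn_gt0 prime_gt0.
    have := ltn_ceil n pk; have := leq_divM n.*2 (p ^ k); nia.
  rewrite divn_small //; apply: leq_trans (trunc_log_ltn _ (prime_gt1 pp)) _.
  by rewrite leq_exp2l // prime_gt1.
rewrite big_split /= -big_distrr /=; have := sumt n.*2; lia.
Qed.

(** For k = 1 the floors are 2 and 1, which cancel; higher powers of p exceed 2n. *)
Lemma logn_central_bin_large p n : prime p -> n.*2 < 3 * p -> p <= n ->
  n.*2 < p ^ 2 -> logn p 'C(n.*2, n) = 0.
Proof.
move=> pp p3 pn p2; have := logn_central_bin n pp.
suff -> : \sum_(1 <= k < n.*2.+1) n.*2 %/ p ^ k =
   2 * \sum_(1 <= k < n.*2.+1) n %/ p ^ k by lia.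
rewrite big_distrr big_nat_cond [RHS]big_nat_cond; apply: eq_bigr => k /andP[/andP[k1 _] _].
have p0 := prime_gt0 pp.
have [ek|k2] : k = 1 \/ 2 <= k by lia.
  have d2 : n.*2 %/ p = 2.
    by rewrite (_ : n.*2 = 2 * p + (n.*2 - 2 * p)) ?divnMDl ?divn_small; lia.
  have d1 : n %/ p = 1.
    by rewrite (_ : n = 1 * p + (n - p)) ?divnMDl ?divn_small; lia.
  by rewrite ek expn1 d1 d2.
have lt : n.*2 < p ^ k by apply: leq_trans p2 _; rewrite leq_exp2l // prime_gt1.
by rewrite !divn_small //; lia.
Qed.

Lemma leq_prod_logn N m F : 0 < N ->
  (forall p, prime p -> m < p -> logn p N = 0) ->
  (forall p, p <= m -> p ^ logn p N <= F p) ->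
  N <= \prod_(0 <= p < m.+1) F p.
Proof.
move=> N0 log0 leF; rewrite -{1}(partnT N0) (@widen_partn (maxn N m)) ?leq_maxl //.
rewrite (@big_cat_nat _ _ _ m.+1) //=; last by rewrite ltnS leq_maxr.
rewrite [X in _ * X]big_nat_cond [X in _ * X]big1 ?muln1 => [|p /andP[/andP[mp _] _]].
  rewrite big_nat_cond [leqRHS]big_nat_cond; apply: leq_prod => p /andP[/andP[_ pm] _].
  exact: leF.
by have [pp|/negbTE np] := boolP (prime p); [rewrite log0|rewrite lognE np].
Qed.

(** With s about sqrt(2n), each index up to s contributes at most 2n, primes in (s, 2n/3] occur at
    most once and are bounded by the primorial, and larger primes do not occur. *)
Lemma central_bin_upper n s : 0 < n -> n.*2 < s.+1 ^ 2 -> 3 * s <= n.*2 ->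
  (forall p, prime p -> ~~ (n < p <= n.*2)) ->
  'C(n.*2, n) <= n.*2 ^ s.+1 * 4 ^ (n.*2 %/ 3).
Proof.
move=> n0 s2 s3 noprime; set m := n.*2 %/ 3.
have N0 : 0 < 'C(n.*2, n) by rewrite bin_gt0; lia.
pose F p := if p <= s then n.*2 else if prime p then p else 1.
have powle p : prime p -> p ^ logn p 'C(n.*2, n) <= n.*2.
  move=> pp; apply: leq_trans (trunc_logP (prime_gt1 pp) _); last lia.
  by rewrite leq_exp2l ?prime_gt1 // logn_central_bin_le.
have large p : s < p -> n.*2 < p ^ 2.
  by move=> lt; apply: leq_trans s2 _; rewrite leq_exp2r.
have sm : s <= m by rewrite /m leq_divRL //; lia.
apply: (@leq_trans (\prod_(0 <= p < m.+1) F p)).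
  apply: leq_prod_logn => // p.
    move=> pp mp; have [pn|np] := leqP p n.
      by apply: logn_central_bin_large => //; [lia | apply: large; lia].
    have lp : n.*2 < p by have := noprime p pp; rewrite np /= -ltnNge.
    apply/eqP; rewrite -leqn0; apply: leq_trans (logn_central_bin_le pp n0) _.
    by rewrite leqn0 trunc_log_eq0; lia.
  move=> _; rewrite /F; have [pp|np] := boolP (prime p); last first.
    by rewrite lognE (negbTE np) expn0; case: ifP => _; lia.
  case: (leqP p s) => [_|sp]; first exact: powle.
  (* The prime power is at most 2n < p^2, so its exponent is at most 1. *)
  rewrite -[leqRHS]expn1 leq_exp2l ?prime_gt1 // -ltnS -(@ltn_exp2l p) ?prime_gt1 //.
  exact: leq_ltn_trans (powle _ pp) (large _ sp).
rewrite (@big_cat_nat _ _ _ s.+1) //=; apply: leq_mul.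
  rewrite big_nat_cond (eq_bigr (fun=> n.*2)); last first.
    by move=> p /andP[/andP[_ ps] _]; rewrite /F -ltnS ps.
  by rewrite -big_nat_cond prod_nat_const_nat subn0.
apply: leq_trans (primorial_le m); rewrite (@prime_prod_cat 0 s) ?sm //.
apply: leq_trans (leq_pmull _ (prime_prod_gt0 0 s)).
rewrite /prime_prod [leqRHS]big_mkcond big_nat_cond [leqRHS]big_nat_cond leq_prod //.
by move=> p /andP[/andP[sp _] _]; rewrite /F [p <= s]leqNgt sp.
Qed.

(** Otherwise 4^n <= (2n)^(s+2) * 4^(2n/3) with s = floor(sqrt(2n)); rounding s+1 up to a power 2^t
    reduces the contradiction to exponents of 2. *)
Lemma bertrand n : 1263 <= n -> exists p, prime p /\ n < p <= n.*2.
Proof.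
move=> len; have [/hasP[p]|/hasPn no] :=
  boolP (has (fun p => prime p && (n < p <= n.*2)) (iota 0 n.*2.+1)).
  by move=> _ /andP[]; exists p.
have noprime p : prime p -> ~~ (n < p <= n.*2).
  move=> pp; apply/negP => /[dup] h /andP[_ pn].
  by have := no p; rewrite mem_iota pp h /= add0n ltnS pn => /(_ isT).
have [s s1 s2] : exists2 s, s ^ 2 <= n.*2 & n.*2 < s.+1 ^ 2.
  have ex : exists s, n.*2 < s.+1 ^ 2 by exists n.*2; nia.
  case: (ex_minnP ex) => s hs min; exists s => //.
  case: s hs min => [|s] hs min; first by rewrite exp0n.
  by rewrite leqNgt; apply/negP => /min; lia.
have s50 : 50 <= s by nia.
pose t := up_log 2 s.+1.
have [t1 t2] : 2 ^ t.-1 <= s /\ s.+1 <= 2 ^ t.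
  by have := @up_log_bounds 2 s.+1 isT; rewrite /t; lia.
(* For t <= 7 this is 49 < 50 <= s; for larger t, 7t <= 2^(t-1) <= s. *)
have ts : 7 * t <= s.
  suff pow7 u : 7 <= u -> 7 * u.+1 <= 2 ^ u.
    by have := pow7 t.-1; lia.
  elim: u => // u IH; rewrite leq_eqVlt => /predU1P[<- //|lt].
  by rewrite expnS; have := IH lt; lia.
have U : 'C(n.*2, n) <= n.*2 ^ s.+1 * 4 ^ (n.*2 %/ 3).
  by apply: central_bin_upper => //; [lia | nia].
have L : 4 ^ n <= n.*2 * 'C(n.*2, n) by apply: central_bin_lower; lia.
have : 4 ^ n < 4 ^ n; last by rewrite ltnn.
have n2t : n.*2 < 2 ^ (2 * t).
  by apply: leq_trans s2 _; rewrite mulnC expnM leq_exp2r.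
apply: leq_ltn_trans L _; apply: leq_ltn_trans (leq_mul (leqnn _) U) _.
rewrite mulnA -expnS.
apply: (@leq_trans (2 ^ (2 * t * s.+2) * 4 ^ (n.*2 %/ 3))).
  by rewrite ltn_pmul2r ?expn_gt0 // expnM ltn_exp2r.
rewrite -[4]/(2 ^ 2) -!expnM -expnD leq_exp2l //.
(* It suffices that 3t(s+2) <= n, which follows from 7t <= s, s^2 <= 2n and s >= 50. *)
have := leq_divM n.*2 3; nia.
Qed.

(** * Counting interactions by type *)

Lemma card_leq_prime_pi (T : finType) (A : {set T}) (f : T -> nat) a b :
  a <= b -> {in A &, injective f} ->
  {in A, forall u, prime (f u) && (a < f u <= b)} ->
  #|A| + prime_pi a <= prime_pi b.
Proof.
move=> leab injf fA; rewrite addnC /prime_pi [leqRHS](@big_cat_nat _ _ _ a.+1) //=.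
rewrite leq_add2l -big_filter sum1_size cardE -(size_map f).
apply: uniq_leq_size => [|_ /mapP[u Au ->]].
  by rewrite map_inj_in_uniq ?enum_uniq // => u v; rewrite !mem_enum; apply: injf.
rewrite mem_enum in Au; have /andP[pu abu] := fA u Au.
by rewrite mem_filter pu mem_index_iota ltnS.
Qed.

Lemma interactionsP E (u : 'I_E * 'I_E) :
  reflect [/\ odd u.1, odd u.2, u.1 <= u.2 & u.1 + u.2 = E] (u \in interactions E).
Proof.
by rewrite inE; apply: (iffP and4P) => [] [? ? ? /eqP].
Qed.

(** The pairs (2i+1, 2n-2i-1) with 2i+1 <= n are distinct interactions. *)
Lemma card_interactions_ge n : uphalf n <= #|interactions n.*2|.
Proof.
have h1 (i : 'I_(uphalf n)) : i.*2.+1 < n.*2 by have := ltn_ord i; lia.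
have h2 (i : 'I_(uphalf n)) : (n.*2 - i.*2.+1) < n.*2 by have := ltn_ord i; lia.
pose f i := (Ordinal (h1 i), Ordinal (h2 i)).
have injf : injective f by move=> i j /(congr1 (fun u => val u.1)) /= ij; apply: ord_inj; lia.
rewrite -[leqLHS]card_ord -(card_imset _ injf); apply/subset_leq_card/subsetP.
move=> _ /imsetP[i _ ->]; apply/interactionsP; have := ltn_ord i.
by split=> /=; lia.
Qed.

(** The only possible diagonal interaction is (n, n), and it requires n odd. *)
Lemma card_diag_le n (P : pred ('I_n.*2 * 'I_n.*2)) :
  #|[set u in interactions n.*2 | (u.1 == u.2) && P u]| <= odd n.
Proof.
have diagn u : u \in [set u in interactions n.*2 | (u.1 == u.2) && P u] ->
  [/\ u.1 = n :> nat, u.2 = n :> nat & odd n].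
  rewrite inE => /andP[/interactionsP[o1 _ _ s] /andP[/eqP e _]].
  have n1 : u.1 = n :> nat by move: s; rewrite -e addnn => /double_inj.
  by split; rewrite -?e // -n1.
case: (boolP (odd n)) => on; last first.
  by rewrite leqn0 cards_eq0; apply/eqP/setP => u; rewrite [RHS]inE;
    apply/negP => /diagn[_ _]; rewrite (negbTE on).
apply/card_le1_eqP => u v /diagn[u1 u2 _] /diagn[v1 v2 _].
rewrite (surjective_pairing u) (surjective_pairing v).
by congr pair; apply: ord_inj; rewrite ?u1 ?u2 ?v1 ?v2.
Qed.

Lemma interaction_fst_inj E (A : {set 'I_E * 'I_E}) : A \subset interactions E ->
  {in A &, injective (fun u : 'I_E * 'I_E => u.1 : nat)}.
Proof.
move=> /subsetP sA u v /sA/interactionsP[_ _ _ su] /sA/interactionsP[_ _ _ sv] e.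
rewrite (surjective_pairing u) (surjective_pairing v) /= in e *.
by congr pair; apply: ord_inj; lia.
Qed.

Lemma interaction_snd_inj E (A : {set 'I_E * 'I_E}) : A \subset interactions E ->
  {in A &, injective (fun u : 'I_E * 'I_E => u.2 : nat)}.
Proof.
move=> /subsetP sA u v /sA/interactionsP[_ _ _ su] /sA/interactionsP[_ _ _ sv] e.
rewrite (surjective_pairing u) (surjective_pairing v) /= in e *.
by congr pair; apply: ord_inj; lia.
Qed.

Lemma odd_prime_gt2 p : prime p -> odd p -> 2 < p.
Proof. by case: p => [|[|[|p]]]. Qed.

Lemma card_nonprime_prime_le n :
  #|[set u in interactions n.*2 | ~~ prime u.1 && prime u.2]| + prime_pi n
    <= prime_pi n.*2.
Proof.
apply: (@card_leq_prime_pi _ _ (fun u : 'I_n.*2 * 'I_n.*2 => u.2 : nat)); first lia.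
  by apply: interaction_snd_inj; apply/subsetP => u; rewrite inE => /andP[].
move=> u; rewrite inE => /andP[/interactionsP[_ _ le s] /andP[np1 p2]] /=.
(* A nonprime differs from a prime, so the second member is strictly above n. *)
rewrite p2 /=; have : u.1 != u.2 :> nat by apply: contraNneq np1 => ->.
move: (u.1 : nat) (u.2 : nat) le s => x y; lia.
Qed.

(** The first members are odd primes up to n; the prime 2 is left out, hence the strict
    inequality. *)
Lemma card_prime_nonprime_lt n : 1 < n ->
  #|[set u in interactions n.*2 | prime u.1 && ~~ prime u.2]| < prime_pi n.
Proof.
move=> n1; have pi2 : prime_pi 2 = 1 by rewrite /prime_pi unlock.
rewrite -addn1 -pi2; apply: (@card_leq_prime_pi _ _ (fun u : 'I_n.*2 * 'I_n.*2 => u.1 : nat)) => //.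
  by apply: interaction_fst_inj; apply/subsetP => u; rewrite inE => /andP[].
move=> u; rewrite inE => /andP[/interactionsP[o1 _ le s] /andP[p1 _]] /=.
rewrite p1 odd_prime_gt2 //=; move: (u.1 : nat) (u.2 : nat) le s => x y; lia.
Qed.

(** A covering suffices for bounding the nonprime pairs from below. Prime pairs form a single class,
    which is empty when d_E = 0. *)
Lemma card_interactions_split E :
  #|interactions E| <=
    #|[set u in interactions E | [&& u.1 != u.2, ~~ prime u.1 & ~~ prime u.2]]|
    + #|[set u in interactions E | (u.1 == u.2) && ~~ prime u.1]|
    + #|[set u in interactions E | ~~ prime u.1 && prime u.2]|
    + #|[set u in interactions E | prime u.1 && ~~ prime u.2]|
    + #|[set u in interactions E | prime u.1 && prime u.2]|.
Proof.
have addU (T : finType) (A B : {set T}) k : #|A| <= k -> #|A :|: B| <= k + #|B|.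
  by move=> le; apply: leq_trans (leq_card_setU _ _) _; rewrite leq_add2r.
have sub (T : finType) (A B : {set T}) k : A \subset B -> #|B| <= k -> #|A| <= k.
  by move/subset_leq_card; apply: leq_trans.
apply: sub; last by do 4!apply: (addU); apply: leqnn.
apply/subsetP => u uI; rewrite !inE; move: uI; rewrite inE => -> /=.
by case: eqVneq; case: (prime u.1); case: (prime u.2).
Qed.

Lemma goldbach_of_pair E :
  0 < #|[set u in interactions E | prime u.1 && prime u.2]| ->
  exists p q : nat, [/\ prime p, prime q, odd p, odd q & E = p + q].
Proof.
case/card_gt0P => u; rewrite inE => /andP[/interactionsP[o1 o2 _ s] /andP[p1 p2]].
by exists u.1, u.2.
Qed.

Lemma card_prime_prime E :
  #|[set u in interactions E | prime u.1 && prime u.2]| =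
  #|[set u in interactions E | [&& u.1 != u.2, prime u.1 & prime u.2]]|
  + #|[set u in interactions E | (u.1 == u.2) && prime u.1]|.
Proof.
rewrite -cardsUI [X in _ = _ + X](_ : _ = 0) ?addn0; last first.
  by apply/eqP; rewrite cards_eq0; apply/eqP/setP => u; rewrite !inE;
    case: (u.1 == u.2); rewrite /= !andbF.
apply: eq_card => u; rewrite !inE.
by case: (eqVneq u.1 u.2) => [->|_]; rewrite /= ?andbF ?orbF ?andbb.
Qed.

(** Bertrand's prime p is odd, hence below 2n, and its partner 2n-p cannot be prime without giving a
    prime pair. *)
Lemma nonprime_prime_gt0 n : 1263 <= n ->
  #|[set u in interactions n.*2 | prime u.1 && prime u.2]| = 0 ->
  0 < #|[set u in interactions n.*2 | ~~ prime u.1 && prime u.2]|.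
Proof.
move=> len D0; have [p [pp /andP[np pn]]] := bertrand len.
have [e|op] := even_prime pp; first lia.
have p2n : p < n.*2.
  by rewrite ltn_neqAle pn andbT; apply: contraTneq op => ->; rewrite odd_double.
have q2n : n.*2 - p < n.*2 by lia.
have uI : (Ordinal q2n, Ordinal p2n) \in interactions n.*2.
  by apply/interactionsP; split=> //=; lia.
apply/card_gt0P; exists (Ordinal q2n, Ordinal p2n); rewrite inE uI /= pp andbT.
apply: contra_eqN D0 => pq; rewrite -lt0n; apply/card_gt0P.
by exists (Ordinal q2n, Ordinal p2n); rewrite inE uI /= pp pq.
Qed.

Lemma prime_nonprime_gt0 n : 3 <= n ->
  #|[set u in interactions n.*2 | prime u.1 && prime u.2]| = 0 ->
  0 < #|[set u in interactions n.*2 | prime u.1 && ~~ prime u.2]|.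
Proof.
move=> len D0; have h3 : 3 < n.*2 by lia. have q2n : n.*2 - 3 < n.*2 by lia.
have uI : (Ordinal h3, Ordinal q2n) \in interactions n.*2.
  by apply/interactionsP; split=> //=; lia.
apply/card_gt0P; exists (Ordinal h3, Ordinal q2n); rewrite inE uI /=.
apply: contra_eqN D0 => pq; rewrite -lt0n; apply/card_gt0P.
by exists (Ordinal h3, Ordinal q2n); rewrite inE uI.
Qed.

(** * Comparison of the four quantities *)

Unset Implicit Arguments.

Local Open Scope ring_scope.

Theorem mainTheorem5 (E : nat) (hE : (2525 < E)%N) (hEeven : ~~ odd E)
  (h1 : ~ [/\ dE E < bE E, bE E < cE E & cE E < aE E])
  (h2 : ~ [/\ dE E < bE E, bE E = cE E & cE E < aE E])
  (h3 : ~ [/\ dE E < cE E, cE E < bE E & bE E < aE E]) :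
  0 < dE E /\
  (exists p q : nat, [/\ prime p, prime q, odd p, odd q & E = (p + q)%N]).
Proof.
have [n en] : exists n, E = n.*2 by exists E./2; rewrite even_halfK.
subst E; have len : (1263 <= n)%N by lia.
have splitD := card_prime_prime n.*2.
have [D0|Dpos] := posnP #|[set u in interactions n.*2 | prime u.1 && prime u.2]|;
  last first.
  split; last exact: goldbach_of_pair.
  move: Dpos; rewrite splitD -(ltr_nat rat) natrD /dE.
  have := ler0n rat #|[set u in interactions n.*2 | [&& u.1 != u.2, prime u.1 & prime u.2]]|.
  have := ler0n rat #|[set u in interactions n.*2 | (u.1 == u.2) && prime u.1]|.
  lra.
exfalso.
have d0 : dE n.*2 = 0.
  move: splitD; rewrite D0 => /esym/eqP; rewrite addn_eq0 => /andP[/eqP e1 /eqP e2].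
  by rewrite /dE e1 e2 mulr0 addr0.
have n1134 : (1134 <= n)%N by lia.
have n3 : (3 <= n)%N by lia.
have Bpos := nonprime_prime_gt0 len D0.
have Cpos := prime_nonprime_gt0 n3 D0.
have Ble := card_nonprime_prime_le n.
have Clt := card_prime_nonprime_lt (ltnW n3).
have A2le := @card_diag_le n (fun u => ~~ prime u.1).
have Ige := leq_trans (card_interactions_ge n) (card_interactions_split n.*2).
have pin := prime_pi_sixth n1134.
have pi2n := prime_pi_double_sub len.
rewrite D0 addn0 in Ige; rewrite d0 /aE /bE /cE in h1 h2 h3.
clear splitD D0 d0; move: Bpos Cpos Ble Clt A2le Ige h1 h2 h3.
set A1 := #|[set u in interactions n.*2 | [&& u.1 != u.2, ~~ prime u.1 & ~~ prime u.2]]|.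
set A2 := #|[set u in interactions n.*2 | (u.1 == u.2) && ~~ prime u.1]|.
set B := #|[set u in interactions n.*2 | ~~ prime u.1 && prime u.2]|.
set C := #|[set u in interactions n.*2 | prime u.1 && ~~ prime u.2]|.
move: A1 A2 B C => A1 A2 B C Bpos Cpos Ble Clt A2le Ige h1 h2 h3.
have BltA : B%:R < A1%:R + 1 / 2 * A2%:R :> rat.
  (* As [2 * uphalf n = n + odd n] and [A2 <= odd n], the right side is at least n - 2B - 2C; and 4B
     + 2C < n because 6B <= n and 6C < n. *)
  have : (2 * B < 2 * A1 + A2)%N by lia.
  rewrite -(ltr_nat rat) natrD !natrM; lra.
have CltA : C%:R < A1%:R + 1 / 2 * A2%:R :> rat.
  have : (2 * C < 2 * A1 + A2)%N by lia.
  rewrite -(ltr_nat rat) natrD !natrM; lra.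
(* The three orderings of B and C match the three excluded relations. *)
have [BC|CB|eBC] := ltngtP B C.
- by apply: h1; split; rewrite ?ltr_nat ?ltr0n.
- by apply: h3; split; rewrite ?ltr_nat ?ltr0n.
- by apply: h2; split; rewrite ?eBC ?ltr0n.
Qed.
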